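(* Let $q\ge 1$ and let $G$ be a $(q+1,q)$-graph that admits a $1$-super graceful labeling in which all vertices receive odd labels; let $v$ be the vertex labeled $1$ in such a labeling. Let $n\ge 2$, let $P_n=u_1u_2\cdots u_n$ be a path, and let $G^v_n$ be the graph obtained from $G$ and $P_n$ by identifying $v$ with $u_1$. Then $G^v_n$ admits a $1$-super graceful labeling in which all vertices receive odd labels and $u_n$ receives the label $1$.
   Context: All graphs are simple, finite, undirected and without isolated vertices; a $(p,q)$-graph has $p$ vertices and $q$ edges. For integers $a\le b$, $[a,b]$ is the set of integers between $a$ and $b$ inclusive. For $k\ge 1$, a $k$-super graceful labeling of a $(p,q)$-graph $G=(V,E)$ is a bijection $f:V\cup E\to[k,k+p+q-1]$ with $f(uv)=|f(u)-f(v)|$ for every edge $uv$. *)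

(* Defs.v *)
From mathcomp Require Import all_boot all_algebra.

Set Implicit Arguments.
Unset Strict Implicit.
Unset Printing Implicit Defensive.

Record sgraph := SGraph {
  vertex :> finType;
  adj : rel vertex;
  adj_sym : symmetric adj;
  adj_irrefl : irreflexive adj;
  adj_noiso : forall x, exists y, adj x y }.

Definition edges (G : sgraph) : {set {set G}} :=
  [set e : {set G} | [exists x, exists y, adj x y && (e == [set x; y])]].

Definition edge (G : sgraph) : Type := {e : {set G} | e \in edges G}.

Lemma edgesP (G : sgraph) (x y : G) : adj x y -> [set x; y] \in edges G.
Proof.
move=> xy; rewrite inE; apply/existsP; exists x; apply/existsP; exists y.
by rewrite xy eqxx.
Qed.

Definition edge_of (G : sgraph) (x y : G) (xy : adj x y) : edge G :=
  exist _ [set x; y] (edgesP xy).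

Definition pq_graph (G : sgraph) (p q : nat) : Prop :=
  #|G| = p /\ #|edges G| = q.

(* The domain V \cup E is the disjoint sum of the vertices and the edges; the
   subtraction under the absolute value is the signed one (absz on int). *)
Definition super_graceful (k : nat) (G : sgraph) (f : G + edge G -> nat) : Prop :=
  [/\ injective f,
      forall m : nat,
        (exists z, f z = m) <-> k <= m <= k + #|G| + #|edges G| - 1
    & forall (x y : G) (xy : adj x y),
        f (inr (edge_of xy)) = `|f (inl x) - f (inl y)|%N].

Section Identification.
Variables (G : sgraph) (v : G) (H : sgraph) (w : H).

(* Vertices of the graph obtained from the disjoint union of G and H by
   identifying w with v; the merged vertex is represented by inl v. *)
Definition ident_vertex : finType := (G + {y : H | y != w})%type.

Definition ident_l (x : G) : ident_vertex := inl x.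

Definition ident_r (y : H) : ident_vertex :=
  if insub y is Some y' then inr y' else inl v.

Definition ident_adj : rel ident_vertex := fun a b =>
  [exists x, exists x', [&& adj x x', a == ident_l x & b == ident_l x']] ||
  [exists y, exists y', [&& adj y y', a == ident_r y & b == ident_r y']].

Lemma ident_r_inj : injective ident_r.
Proof.
move=> y1 y2; rewrite /ident_r.
case: insubP => [u1 _ <-|]; case: insubP => [u2 _ <-|] //; first by case=> ->.
by rewrite !negbK => /eqP-> /eqP->.
Qed.

Lemma ident_adjP a b :
  reflect ((exists x x', [/\ adj x x', a = ident_l x & b = ident_l x']) \/
           (exists y y', [/\ adj y y', a = ident_r y & b = ident_r y']))
          (ident_adj a b).
Proof.
apply: (iffP orP) => -[].
- by move=> /existsP[x /existsP[x' /and3P[? /eqP? /eqP?]]]; left; exists x, x'.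
- by move=> /existsP[x /existsP[x' /and3P[? /eqP? /eqP?]]]; right; exists x, x'.
- move=> [x [x' [h -> ->]]]; left; apply/existsP; exists x; apply/existsP.
  by exists x'; rewrite h !eqxx.
- move=> [x [x' [h -> ->]]]; right; apply/existsP; exists x; apply/existsP.
  by exists x'; rewrite h !eqxx.
Qed.

Lemma ident_adj_sym : symmetric ident_adj.
Proof.
suff h a b : ident_adj a b -> ident_adj b a by move=> a b; apply/idP/idP; apply: h.
by move=> /ident_adjP[] [x [x' [h -> ->]]]; apply/ident_adjP; [left|right];
   exists x', x; rewrite adj_sym.
Qed.

Lemma ident_adj_irrefl : irreflexive ident_adj.
Proof.
move=> a; apply/negP => /ident_adjP[] [x [x' [h ->]]].
  by case=> E; move: h; rewrite E adj_irrefl.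
by move=> /ident_r_inj E; move: h; rewrite E adj_irrefl.
Qed.

Lemma ident_adj_noiso a : exists b, ident_adj a b.
Proof.
case: a => [x|[y yw]].
  have [x' h] := adj_noiso x; exists (ident_l x').
  by apply/ident_adjP; left; exists x, x'.
have [y' h] := adj_noiso y; exists (ident_r y').
apply/ident_adjP; right; exists y, y'; split=> //.
by rewrite /ident_r insubT.
Qed.

Definition ident : sgraph :=
  SGraph ident_adj_sym ident_adj_irrefl ident_adj_noiso.

End Identification.

Section Path.
Variables (n : nat) (n_ge2 : 2 <= n).

(* The index i : 'I_n stands for u_(i+1). *)
Definition path_adj : rel 'I_n := fun i j => (i.+1 == j) || (j.+1 == i).

Lemma path_adj_sym : symmetric path_adj.
Proof. by move=> i j; rewrite /path_adj orbC. Qed.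

Lemma path_adj_irrefl : irreflexive path_adj.
Proof. by move=> i; rewrite /path_adj orbb gtn_eqF. Qed.

Lemma path_adj_noiso i : exists j, path_adj i j.
Proof.
case: (posnP i) => [i0|i_gt0].
  by exists (Ordinal n_ge2); rewrite /path_adj i0.
have h : i.-1 < n by rewrite (leq_ltn_trans (leq_pred i)).
by exists (Ordinal h); rewrite /path_adj /= prednK // eqxx orbT.
Qed.

Definition path_graph : sgraph :=
  SGraph path_adj_sym path_adj_irrefl path_adj_noiso.

Lemma path_last_subproof : n.-1 < n.
Proof. by rewrite prednK // ltnW. Qed.

Definition path_first : path_graph := Ordinal (ltnW n_ge2).
Definition path_last : path_graph := Ordinal path_last_subproof.

End Path.

Definition attach_path (G : sgraph) (v : G) (n : nat) (n_ge2 : 2 <= n) : sgraph :=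
  ident v (path_first n_ge2).

Definition attach_path_end (G : sgraph) (v : G) (n : nat) (n_ge2 : 2 <= n) :
    attach_path v n_ge2 :=
  ident_r v (path_first n_ge2) (path_last n_ge2).

(* Main.v *)
Require Import Defs.
From mathcomp Require Import all_boot all_algebra.
From mathcomp Require Import zify.

Set Implicit Arguments.
Unset Strict Implicit.
Unset Printing Implicit Defensive.

(** Writing the label of a vertex as [2 l + 1], a 1-super graceful labeling
    with odd vertex labels of a (q+1,q)-graph is the same as a classical graceful
    labeling [l] with values in [0,q].  With [m = n - 1] and [Q = q + m], the path
    is labeled from its free end by the zigzag [0, Q, 1, Q - 1, ...], whose
    consecutive differences are [Q, Q - 1, ..., q + 1].  The vertices of [G]
    receive the remaining interval of length [q]: their labels are shifted, or
    reflected and shifted, according to the parity of [m], so that the vertex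
    labeled [0] lands on the [m]-th term of the zigzag. *)

(** Edges appear only as adjacent pairs, compared as unordered sets, so the induced edge labels need
    no function on [edge G]. *)
Definition graceful (G : sgraph) (q : nat) (l : G -> nat) : Prop :=
  [/\ injective l,
      forall x, l x <= q,
      forall x y x' y', adj x y -> adj x' y' ->
        `|l x - l y|%N = `|l x' - l y'|%N -> [set x; y] = [set x'; y']
    & forall d, 0 < d <= q -> exists x y, adj x y /\ `|l x - l y|%N = d].

Lemma edge_exists (G : sgraph) (e : edge G) :
  exists x y (xy : adj x y), e = edge_of xy.
Proof.
have := valP e; rewrite inE => /existsP[x /existsP[y /andP[xy /eqP ee]]].
by exists x, y, xy; apply: val_inj.
Qed.

Section OfSuperGraceful.
Variables (G : sgraph) (q : nat) (f : G + edge G -> nat).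
Hypotheses (hG : pq_graph G q.+1 q) (hf : super_graceful 1 f).
Hypothesis (hodd : forall x : G, odd (f (inl x))).

(** Differences of odd labels are even, so an even label [d.*2] in the range up to [2q + 1] must sit
    on an edge; halving turns it into the difference [d]. *)
Lemma super_graceful_graceful : graceful q (fun x => (f (inl x))./2).
Proof.
case: hG => cV cE; case: hf => finj frng fadj; split.
- move=> x y xy; have /finj[] // : f (inl x) = f (inl y).
  by have := hodd x; have := hodd y; lia.
- move=> x; have /frng : exists z, f z = f (inl x) by exists (inl x).
  by have := hodd x; rewrite cV cE; lia.
- move=> x y x' y' xy xy' dE.
  have /finj[] // : f (inr (edge_of xy)) = f (inr (edge_of xy')).
  rewrite !fadj.
  by have := hodd x; have := hodd y; have := hodd x'; have := hodd y'; lia.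
- move=> d dq; have /frng[z] : 1 <= d.*2 <= 1 + #|G| + #|edges G| - 1.
    by rewrite cV cE; lia.
  case: z => [x|e] fE; first by have := hodd x; rewrite fE odd_double.
  have [x [y [xy eE]]] := edge_exists e; exists x, y; split=> //.
  by move: fE; rewrite eE fadj; have := hodd x; have := hodd y; lia.
Qed.

End OfSuperGraceful.

Section ToSuperGraceful.
Variables (G : sgraph) (q : nat) (l : G -> nat).
Hypotheses (cV : #|G| = q.+1) (hl : graceful q l).

(** An edge is a set without a chosen order of its ends; maximizing the truncated difference over
    both orders recovers the absolute value. *)
Definition diam_label (e : {set G}) : nat :=
  \max_(x in e) \max_(y in e) (l x - l y).

Lemma diam_label_pair x y : diam_label [set x; y] = `|l x - l y|%N.
Proof.
apply/eqP; rewrite eqn_leq; apply/andP; split.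
  apply/bigmax_leqP => a /set2P ha; apply/bigmax_leqP => b /set2P hb.
  by case: ha => ->; case: hb => ->; lia.
have le a b : a \in [set x; y] -> b \in [set x; y] ->
    l a - l b <= diam_label [set x; y].
  move=> ha hb; apply: leq_trans (leq_bigmax_cond _ ha).
  exact: (leq_bigmax_cond b hb).
have := le x y (set21 _ _) (set22 _ _); have := le y x (set22 _ _) (set21 _ _).
by lia.
Qed.

Lemma diam_label_inj : {in edges G &, injective diam_label}.
Proof.
case: hl => _ _ linj _ e e' he he'.
have [x [y [xy [eE]]]] := edge_exists (exist _ e he).
have [x' [y' [xy' [eE']]]] := edge_exists (exist _ e' he').
by rewrite eE eE' !diam_label_pair; apply: linj.
Qed.

Lemma diam_label_gt0_le e : e \in edges G -> 0 < diam_label e <= q.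
Proof.
case: hl => linj lq _ _ he.
have [x [y [xy [eE]]]] := edge_exists (exist _ e he).
rewrite eE diam_label_pair; have := lq x; have := lq y.
have : l x <> l y by move=> /linj xyE; rewrite xyE adj_irrefl in xy.
by lia.
Qed.

Lemma diam_label_surj d : 0 < d <= q ->
  exists2 e, e \in edges G & diam_label e = d.
Proof.
case: hl => _ _ _ lsurj /lsurj[x [y [xy dE]]].
by exists [set x; y]; [apply: edgesP | rewrite diam_label_pair].
Qed.

(** [diam_label] is a bijection from the edges onto [[1, q]], which spares a direct edge count in
    the graph with the path attached. *)
Lemma graceful_card_edges : #|edges G| = q.
Proof.
rewrite cardE -(size_map diam_label) -[RHS](size_iota 1); apply: perm_size.
apply: uniq_perm; rewrite ?iota_uniq //.
  rewrite map_inj_in_uniq ?enum_uniq // => e e'.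
  by rewrite !mem_enum; apply: diam_label_inj.
move=> d; rewrite mem_iota add1n ltnS; apply/mapP/idP.
  by move=> [e]; rewrite mem_enum => /diam_label_gt0_le h ->.
by move=> /diam_label_surj[e he dE]; exists e; rewrite ?mem_enum.
Qed.

(** Pigeonhole: [q.+1] vertices are labeled injectively by [q.+1] values. *)
Lemma graceful_surj k : k <= q -> exists x, l x = k.
Proof.
case: hl => linj lq _ _ kq.
pose o x : 'I_q.+1 := inord (l x).
have oE x : o x = l x :> nat by rewrite inordK // ltnS lq.
have oinj : injective o.
  by move=> x y /(congr1 val) /=; rewrite !oE => /linj.
have /codomP[x xE] : inord k \in codom o.
  by rewrite inj_card_onto // cV card_ord.
by exists x; rewrite -oE -xE inordK.
Qed.

Lemma graceful_super_graceful : exists g : G + edge G -> nat,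
  super_graceful 1 g /\ forall x, g (inl x) = (l x).*2.+1.
Proof.
case: (hl) => linj lq _ _.
exists (fun z => match z with
  | inl x => (l x).*2.+1 | inr e => (diam_label (val e)).*2 end).
split=> //; split.
- move=> [x|e] [y|e'].
  + by move=> xy; congr inl; apply: linj; lia.
  + by lia.
  + by lia.
  + move=> ee; congr inr; apply/val_inj/diam_label_inj; try exact: valP.
    by lia.
- move=> k; rewrite cV graceful_card_edges; split.
    move=> [[x|e] <-]; first by have := lq x; lia.
    by have := diam_label_gt0_le (valP e); lia.
  move=> kq; case: (boolP (odd k)) => ok.
    have [|x xE] := @graceful_surj k./2; first by lia.
    by exists (inl x); rewrite xE; lia.
  have [|e he eE] := @diam_label_surj k./2; first by lia.
  by exists (inr (exist _ e he)); rewrite /= eE; lia.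
- by move=> x y xy; rewrite /= diam_label_pair; lia.
Qed.

End ToSuperGraceful.

Section AttachPath.
Variables (G : sgraph) (q : nat) (l : G -> nat) (v : G).
Hypotheses (hl : graceful q l) (lv : l v = 0).
Variables (n : nat) (hn : 2 <= n).

Let m := n.-1.

(** The index [j] is the distance to the free end of the path. *)
Definition zigzag (j : nat) : nat := if odd j then q + m - j./2 else j./2.

Definition core_label (t : nat) : nat :=
  if odd m then q + m - m./2 - t else m./2 + t.

Definition attach_label (a : attach_path v hn) : nat :=
  match a with
  | inl x => core_label (l x)
  | inr y => zigzag (m - (val y : 'I_n))
  end.

Lemma attach_label_l x : attach_label (ident_l (path_first hn) x) = core_label (l x).
Proof. by []. Qed.

(** The merged vertex is labeled as a vertex of [G]; this is consistent because [core_label 0]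
    equals [zigzag m]. *)
Lemma attach_label_r (y : 'I_n) :
  attach_label (ident_r v (path_first hn) y) = zigzag (m - y).
Proof.
rewrite /ident_r; case: insubP => [u _ <-//|/negPn/eqP->] /=.
by rewrite lv /core_label /zigzag !subn0 addn0.
Qed.

(** Consecutive indices have opposite parity, and their halves rounded down add up to the smaller
    index. *)
Lemma zigzag_step i j : i <= m -> j <= m -> i = j.+1 \/ j = i.+1 ->
  `|zigzag i - zigzag j|%N = q + m - minn i j.
Proof. by rewrite /zigzag; case: ifP; case: ifP; lia. Qed.

Lemma core_label_dist s t : s <= q -> t <= q ->
  `|core_label s - core_label t|%N = `|s - t|%N.
Proof. by rewrite /core_label; case: ifP; lia. Qed.

Lemma zigzag_inj i j : i <= m -> j <= m -> zigzag i = zigzag j -> i = j.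
Proof. by rewrite /zigzag; case: ifP; case: ifP; lia. Qed.

(** Before index [m], the even terms lie strictly below the interval filled by [core_label] and the
    odd terms strictly above it. *)
Lemma core_zigzag_neq t j : t <= q -> j < m -> core_label t <> zigzag j.
Proof. by rewrite /core_label /zigzag; case: ifP; case: ifP; lia. Qed.

Lemma attach_label_graceful :
  graceful (q + m) attach_label.
Proof.
case: hl => linj lq luniq lsurj.
have ym (y : 'I_n) : y <= m by rewrite /m; have := ltn_ord y; lia.
have yj (y : 'I_n) : y != path_first hn -> m - y < m.
  move=> yw; have : y != 0 :> nat.
    by apply: contraNneq yw => y0; apply/eqP/val_inj.
  by have := ym y; lia.
have dG x x' : adj x x' -> `|core_label (l x) - core_label (l x')|%N <= q.
  by move=> _; rewrite core_label_dist //; have := lq x; have := lq x'; lia.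
(* Reversing the index by [m - y] turns the minimum of [zigzag_step] into a maximum. *)
have dP (y y' : 'I_n) : path_adj y y' ->
    `|zigzag (m - y) - zigzag (m - y')|%N = q + maxn y y'.
  move=> /orP yy'; have yn := ltn_ord y; have yn' := ltn_ord y'.
  have {}yy' : y.+1 = y' \/ y'.+1 = y by case: yy' => /eqP; [left|right].
  by rewrite zigzag_step /m; lia.
split.
- move=> [x|[y yw]] [x'|[y' yw']] /= E.
  + congr inl; apply: linj; have := core_label_dist (lq x) (lq x').
    by rewrite E; lia.
  + by case: (core_zigzag_neq (lq x) (yj _ yw') E).
  + by case: (core_zigzag_neq (lq x') (yj _ yw)); rewrite E.
  + congr inr; apply/val_inj/val_inj => /=.
    have yn := yj _ yw; have yn' := yj _ yw'.
    by have := zigzag_inj (ltnW yn) (ltnW yn') E;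
      have := ym y; have := ym y'; lia.
- move=> [x|[y yw]] /=.
    by rewrite /core_label; have := lq x; case: ifP; lia.
  by rewrite /zigzag; have := yj _ yw; case: ifP; lia.
- move=> a b a' b' /ident_adjP[] [x [y [xy -> ->]]]
    /ident_adjP[] [x' [y' [xy' -> ->]]];
    rewrite ?attach_label_l ?attach_label_r.
  + rewrite !core_label_dist // => /(luniq _ _ _ _ xy xy') E.
    have := congr1 (fun A : {set G} => ident_l (path_first hn) @: A) E.
    by rewrite !imsetU1 !imset_set1.
  (* An edge of [G] has difference at most [q], an edge of the path more than [q]. *)
  + rewrite (dP _ _ xy'); have := dG _ _ xy.
    by move: xy' => /orP[] /eqP; lia.
  + rewrite (dP _ _ xy); have := dG _ _ xy'.
    by move: xy => /orP[] /eqP; lia.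
  (* A path edge is determined by its larger index. *)
  + rewrite (dP _ _ xy) (dP _ _ xy') => E.
    have [[-> ->] //|[-> ->]] : (x = x' /\ y = y') \/ (x = y' /\ y = x').
      move: xy xy' => /orP[] /eqP h /orP[] /eqP h'; [left|right|right|left];
      by split; apply: val_inj => /=; lia.
    by rewrite setUC.
- move=> d /andP[d0 dqm]; case: (leqP d q) => dq.
    have [|x [y [xy dE]]] := lsurj d; first by rewrite d0.
    exists (ident_l (path_first hn) x), (ident_l (path_first hn) y); split.
      by apply/ident_adjP; left; exists x, y.
    by rewrite core_label_dist.
  (* A difference [d > q] is realized on the path edge whose larger index is [d - q]. *)
  have hi : (d - q).-1 < n by lia.
  have hj : d - q < n by lia.
  have ij : adj (Ordinal hi : path_graph hn) (Ordinal hj).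
    by apply/orP; left; apply/eqP => /=; lia.
  exists (ident_r v (path_first hn) (Ordinal hi)).
  exists (ident_r v (path_first hn) (Ordinal hj)); split.
    by apply/ident_adjP; right; exists (Ordinal hi), (Ordinal hj).
  by rewrite !attach_label_r (dP _ _ ij) /=; lia.
Qed.

Lemma attach_label_end : attach_label (attach_path_end v hn) = 0.
Proof. by rewrite attach_label_r /= subnn. Qed.

Lemma card_attach_path : #|attach_path v hn| = #|G| + m.
Proof.
rewrite card_sum; congr (_ + _).
by rewrite card_sig (cardC1 (path_first hn)) card_ord.
Qed.

End AttachPath.

Theorem theorem2p10 (q : nat) (hq : 1 <= q) (G : sgraph)
    (hG : pq_graph G q.+1 q)
    (f : G + edge G -> nat) (hf : super_graceful 1 f)
    (hodd : forall x : G, odd (f (inl x)))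
    (v : G) (hv : f (inl v) = 1)
    (n : nat) (hn : 2 <= n) :
  exists g : attach_path v hn + edge (attach_path v hn) -> nat,
    [/\ super_graceful 1 g,
        forall x : attach_path v hn, odd (g (inl x))
      & g (inl (attach_path_end v hn)) = 1].
Proof.
have hl := super_graceful_graceful hG hf hodd.
have lv : (f (inl v))./2 = 0 by rewrite hv.
have ha := attach_label_graceful hl lv hn.
have [|g [hg gE]] := graceful_super_graceful _ ha.
  by rewrite card_attach_path hG.1.
exists g; split=> [//|x|]; first by rewrite gE /= odd_double.
by rewrite gE attach_label_end.
Qed.
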